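(* Let $N$ be a network representing a $k$-submodular function $f:{S_k}^n\to\mathbb{R}\cup\{+\infty\}$, and let $G$ be the residual graph corresponding to a maximum $(s,t)$-flow of $N$. Let $\Sigma$ be the set of strongly connected components (sccs) of $G$ other than the following: (1) sccs reachable from $s$; (2) sccs reachable to $t$ (i.e. from which $t$ is reachable); (3) sccs reachable to an scc containing two or more elements of $U_i$ for some $i\in\{1,\dots,n\}$; (4) sccs reachable to sccs $X$ and $Y$ such that $X\ne Y$ and $|X\cap U_i|=|Y\cap U_i|=1$ for some $i\in\{1,\dots,n\}$. Define a partial order $\le$ on $\Sigma$ by $X\le Y$ if and only if $X$ is reachable from $Y$ on $G$. Let $\smile$ be the symmetric binary relation on $\Sigma$ defined by: $X\smile Y$ if and only if there are distinct $X',Y'\in\Sigma$ such that $X'\le X$, $Y'\le Y$ and $|X'\cap U_i|=|Y'\cap U_i|=1$ for some $i\in\{1,\dots,n\}$. Then $\Sigma$ forms an elementary PIP with inconsistency relation $\smile$. The consistent ideal family of $\Sigma$ (ordered by inclusion) is isomorphic to the minimizer set of $f$ (ordered by $\preceq$), where the isomorphism is $\psi^{-1}\circ\tau$, with $\tau(I)=X_0\cup\bigcup_{X\in I}X$ and $X_0$ the set of vertices reachable from $s$ in $G$.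
   Context: $k$-submodular functions. $S_k=\{0,1,\dots,k\}$ is partially ordered by $a\preceq b$ iff $a\in\{0,b\}$; ${S_k}^n$ has the componentwise order $\preceq$. Define $x\sqcap y$, $x\sqcup y$ componentwise: if $x_i,y_i$ are comparable, $(x\sqcap y)_i=\min\{x_i,y_i\}$, $(x\sqcup y)_i=\max\{x_i,y_i\}$ (with respect to $\preceq$); otherwise both are $0$. $f:{S_k}^n\to\mathbb{R}\cup\{+\infty\}$ is $k$-submodular if $f(x)+f(y)\ge f(x\sqcap y)+f(x\sqcup y)$ for all $x,y$. The minimizer set is the set of $x$ with $f(x)\le f(y)$ for all $y\in{S_k}^n$. Networks. $N=(V,A,c)$ is a directed network with vertex set $V$, edge set $A$, nonnegative edge capacity $c$, where $V$ consists of a source $s$, a sink $t$ and vertices $v_i^\alpha$ for $i\in\{1,\dots,n\}$, $\alpha\in\{1,\dots,k\}$. Put $U_i=\{v_i^1,\dots,v_i^k\}$. An $(s,t)$-cut is $X\subseteq V$ with $s\in X$, $t\notin X$; it is legal if $|X\cap U_i|\le1$ for every $i$. Its capacity $c(X)$ is the sum of the capacities of all edges from $X$ to $V\setminus X$. The bijection $\psi$ from ${S_k}^n$ to the set of legal $(s,t)$-cuts is $\psi(x)=\{s\}\cup\{v_i^{x_i}: x_i\neq0\}$. For an $(s,t)$-cut $X$, $\check X$ is the legal $(s,t)$-cut obtained by removing the vertices in $X\cap U_i$ from $X$ for every $i$ with $|X\cap U_i|\ge2$. $N$ represents $f$ if (NR1) there is a constant $K\in\mathbb{R}$ with $f(x)=c(\psi(x))+K$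 for all $x\in{S_k}^n$, and (NR2) $c(\check X)\le c(X)$ for all $(s,t)$-cuts $X$. The residual graph corresponding to an $(s,t)$-flow $\phi$ is the directed graph $(V,A_\phi)$ with $A_\phi=\{a\in A:\phi(a)<c(a)\}\cup\{(u,v)\in V\times V: (v,u)\in A,\ 0<\phi(v,u)\}$. PIPs. A poset with inconsistent pairs (PIP) is a finite poset $(P,\le)$ with a symmetric relation $\smile$ such that (IC1) if $p\smile q$ there is no $r\in P$ with $p\le r$, $q\le r$; (IC2) if $p'\le p$, $q'\le q$ and $p'\smile q'$, then $p\smile q$. A pair $\{p,q\}$ with $p\smile q$ is inconsistent; it is minimally inconsistent if $p'\le p$, $q'\le q$, $p'\smile q'$ imply $p'=p$, $q'=q$. An ideal (down-closed subset, possibly empty) is consistent if it contains no inconsistent pair. A PIP $P$ is elementary if: (EP0) $P$ is the disjoint union of (possibly empty) sets $P_1,\dots,P_n$ such that every pair $\{x,y\}$ of distinct elements is minimally inconsistent iff $\{x,y\}\subseteq P_i$ for some $i$; (EP1) for distinct $i,j$, if $|P_i|\ge2$ and $P_j=\{y\}$, there is no $x\in P_i$ with $x<y$; (EP2) for distinct $i,j$ with $|P_i|,|P_j|\ge2$, either (EP2-1) every pair of $x\in P_i$, $y\in P_j$ is not comparable, or (EP2-2) there exist $x^\circ\in P_i$, $y^\circ\in P_j$ such that $x^\circ<y$ and $y^\circ<x$ for all $x\in P_i\setminus\{x^\circ\}$, $y\in P_j\setminus\{y^\circ\}$. (The number of parts $n$ in (EP0) need not equal the arity of $f$.) *)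

(* Defs.v *)
From HB Require Import structures.
From mathcomp Require Import all_boot all_order all_algebra.
From mathcomp Require Import reals constructive_ereal.

Set Implicit Arguments.
Unset Strict Implicit.
Unset Printing Implicit Defensive.

Import Order.TTheory GRing.Theory Num.Theory.

Local Open Scope ring_scope.

Section KSubmodular.
Variables (R : realType) (n k : nat).

Definition kle (a b : 'I_k.+1) : bool := (a == ord0) || (a == b).

Definition kmeet (a b : 'I_k.+1) : 'I_k.+1 :=
  if kle a b then a else if kle b a then b else ord0.

Definition kjoin (a b : 'I_k.+1) : 'I_k.+1 :=
  if kle a b then b else if kle b a then a else ord0.

Definition kvec := {ffun 'I_n -> 'I_k.+1}.

Definition kvle (x y : kvec) : bool := [forall i, kle (x i) (y i)].
Definition kvmeet (x y : kvec) : kvec := [ffun i => kmeet (x i) (y i)].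
Definition kvjoin (x y : kvec) : kvec := [ffun i => kjoin (x i) (y i)].

Definition ksubmodular (f : kvec -> \bar R) : Prop :=
  (forall x, f x != -oo%E) /\
  (forall x y, (f (kvmeet x y) + f (kvjoin x y) <= f x + f y)%E).

Definition minimizers (f : kvec -> \bar R) : {set kvec} :=
  [set x | [forall y, (f x <= f y)%E]].

End KSubmodular.

(* The superscript alpha in {1, ..., k} of a vertex v_i^alpha is encoded as
   alpha - 1 : 'I_k; it corresponds to the label lift ord0 (alpha - 1), whose
   value is alpha, in {0, ..., k} = 'I_k.+1. *)
Inductive vertex (n k : nat) : Type :=
| Source
| Sink
| Node of 'I_n & 'I_k.

Arguments Source {n k}.
Arguments Sink {n k}.
Arguments Node {n k} i a.

Definition vertex_code n k (v : vertex n k) : bool + 'I_n * 'I_k :=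
  match v with
  | Source => inl true
  | Sink => inl false
  | Node i a => inr (i, a)
  end.

Definition vertex_decode n k (w : bool + 'I_n * 'I_k) : vertex n k :=
  match w with
  | inl true => Source
  | inl false => Sink
  | inr (i, a) => Node i a
  end.

Lemma vertex_codeK n k : cancel (@vertex_code n k) (@vertex_decode n k).
Proof. by case. Qed.

HB.instance Definition _ n k := Finite.copy (vertex n k)
  (can_type (@vertex_codeK n k)).

Section Cuts.
Variables (n k : nat).
Local Notation V := (vertex n k).

Definition layer (i : 'I_n) : {set V} := [set Node i a | a : 'I_k].

Definition st_cut (X : {set V}) : bool := (Source \in X) && (Sink \notin X).

Definition legal_cut (X : {set V}) : bool :=
  st_cut X && [forall i, #|X :&: layer i| <= 1]%N.

(* Every layer met in at least two vertices is emptied, not thinned to one. *)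
Definition legalize (X : {set V}) : {set V} :=
  X :\: \bigcup_(i | (2 <= #|X :&: layer i|)%N) layer i.

Definition psi (x : kvec n k) : {set V} :=
  Source |: [set v | if v is Node i a then x i == lift ord0 a else false].

Definition psi_inv (X : {set V}) : kvec n k :=
  [ffun i => if [pick a | Node i a \in X] is Some a then lift ord0 a else ord0].

Lemma psi_legal x : legal_cut (psi x).
Proof.
rewrite /legal_cut /st_cut !inE eqxx /=; apply/forallP => i.
apply/card_le1_eqP => u v; rewrite !inE.
case/andP=> Hu /imsetP[a _ Ea] /andP[Hv /imsetP[b _ Eb]].
move: Hu Hv; rewrite {}Ea {}Eb /= => /eqP-> /eqP/lift_inj.
by move=> ->.
Qed.

Lemma psiK : cancel psi psi_inv.
Proof.
move=> x; apply/ffunP => i; rewrite ffunE; case: pickP => [a|no].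
  by rewrite !inE /= => /eqP.
case: (unliftP ord0 (x i)) => [a Ea|->//].
by have:= no a; rewrite !inE /= Ea eqxx.
Qed.

Lemma psi_invK : {in legal_cut, cancel psi_inv psi}.
Proof.
move=> X /andP[/andP[sX tX] /forallP lX]; apply/setP=> v.
rewrite !inE; case: v => [|| i a] /=; rewrite ?sX ?(negbTE tX) //.
rewrite ffunE; case: pickP => [b bX|->] /=; last first.
  by apply/eqP => E; have:= congr1 val E.
rewrite (inj_eq lift_inj); apply/eqP/idP => [<- //|aX].
have [] // : Node i b = Node i a.
by apply: (card_le1_eqP (lX i)); rewrite inE ?bX ?aX; apply/imset_f.
Qed.

End Cuts.

(* The values of capacity outside edges are irrelevant; +oo is a legitimate
   capacity, since the represented functions may take the value +oo. *)
Record network (R : realType) (n k : nat) := Network {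
  edges : {set vertex n k * vertex n k};
  capacity : vertex n k * vertex n k -> \bar R;
  capacity_ge0 : forall a, a \in edges -> (0 <= capacity a)%E
}.

Section Networks.
Variables (R : realType) (n k : nat) (N : network R n k).
Local Notation V := (vertex n k).

Definition cut_capacity (X : {set V}) : \bar R :=
  (\sum_(a in edges N | (a.1 \in X) && (a.2 \notin X)) capacity N a)%E.

Definition represents (f : kvec n k -> \bar R) : Prop :=
  (exists K : R, forall x, f x = (cut_capacity (psi x) + K%:E)%E) /\
  (forall X, st_cut X -> (cut_capacity (legalize X) <= cut_capacity X)%E).

Implicit Type phi : V * V -> R.

Definition inflow phi (v : V) : R := \sum_(a in edges N | a.2 == v) phi a.
Definition outflow phi (v : V) : R := \sum_(a in edges N | a.1 == v) phi a.

Definition is_flow phi : Prop :=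
  (forall a, a \in edges N -> 0 <= phi a /\ ((phi a)%:E <= capacity N a)%E) /\
  (forall v, v != Source -> v != Sink -> inflow phi v = outflow phi v).

Definition flow_value phi : R := outflow phi Source - inflow phi Source.

Definition is_max_flow phi : Prop :=
  is_flow phi /\ (forall phi', is_flow phi' -> flow_value phi' <= flow_value phi).

Variable phi : V * V -> R.

Definition residual : rel V := fun u v =>
  ((u, v) \in edges N) && ((phi (u, v))%:E < capacity N (u, v))%E
  || ((v, u) \in edges N) && (0 < phi (v, u)).

Definition reach : rel V := connect residual.

Definition sccs : {set {set V}} :=
  equivalence_partition (fun u v => reach u v && reach v u) [set: V].

Definition scc_reach : rel {set V} := fun X Y =>
  [exists u in X, exists v in Y, reach u v].

Definition reachable_from_source (X : {set V}) : bool := [exists v in X, reach Source v].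

Definition reachable_to_sink (X : {set V}) : bool := [exists v in X, reach v Sink].

Definition reachable_to_crowded (X : {set V}) : bool :=
  [exists Y in sccs, scc_reach X Y &&
    [exists i, 2 <= #|Y :&: layer k i|]%N].

Definition meet_same_layer (X Y : {set V}) : bool :=
  [exists i, (#|X :&: layer k i| == 1)%N && (#|Y :&: layer k i| == 1)%N].

Definition reachable_to_conflict (X : {set V}) : bool :=
  [exists Y in sccs, exists Z in sccs,
    [&& Y != Z, scc_reach X Y, scc_reach X Z & meet_same_layer Y Z]].

Definition Sigma : {set {set V}} :=
  [set X in sccs |
     ~~ [|| reachable_from_source X, reachable_to_sink X,
            reachable_to_crowded X | reachable_to_conflict X]].

Definition Sigma_type : finType := {X : {set V} | X \in Sigma}.

(* X <= Y when X is reachable from Y, so that ideals give residual-closed sets. *)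
Definition Sigma_le : rel Sigma_type := fun X Y => scc_reach (val Y) (val X).

Definition Sigma_inc : rel Sigma_type := fun X Y =>
  [exists X' : Sigma_type, exists Y' : Sigma_type,
    [&& X' != Y', Sigma_le X' X, Sigma_le Y' Y
      & meet_same_layer (val X') (val Y')]].

Definition X0 : {set V} := [set v | reach Source v].

Definition tau (I : {set Sigma_type}) : {set V} :=
  X0 :|: \bigcup_(X in I) val X.

End Networks.

Arguments Sigma_le {R n k} N phi.
Arguments Sigma_inc {R n k} N phi.
Arguments tau {R n k} N phi I.

Section PIP.
Variables (T : finType) (le inc : rel T).

Definition is_pip : Prop :=
  [/\ [/\ reflexive le, antisymmetric le & transitive le],
      symmetric inc,
      (forall p q, inc p q -> ~ exists r, le p r /\ le q r)
    & (forall p q p' q', le p' p -> le q' q -> inc p' q' -> inc p q)].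

Definition min_inc (p q : T) : Prop :=
  inc p q /\
  (forall p' q', le p' p -> le q' q -> inc p' q' -> p' = p /\ q' = q).

Definition slt (x y : T) : bool := (x != y) && le x y.

(* Parts may be empty; on distinct elements, being minimally inconsistent must
   coincide with lying in the same part. *)
Definition EP0 m (P : 'I_m -> {set T}) : Prop :=
  [/\ \bigcup_i P i = [set: T],
      (forall i j, i != j -> [disjoint P i & P j])
    & (forall x y, x != y ->
         (min_inc x y <-> exists i, x \in P i /\ y \in P i))].

Definition EP1 m (P : 'I_m -> {set T}) : Prop :=
  forall i j y, i != j -> (2 <= #|P i|)%N -> P j = [set y] ->
    ~ exists x, x \in P i /\ slt x y.

Definition EP2 m (P : 'I_m -> {set T}) : Prop :=
  forall i j, i != j -> (2 <= #|P i|)%N -> (2 <= #|P j|)%N ->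
    (forall x y, x \in P i -> y \in P j -> ~~ le x y /\ ~~ le y x) \/
    (exists x0 y0, [/\ x0 \in P i, y0 \in P j &
       forall x y, x \in P i :\ x0 -> y \in P j :\ y0 -> slt x0 y /\ slt y0 x]).

Definition is_elementary_pip : Prop :=
  is_pip /\ exists m (P : 'I_m -> {set T}), [/\ EP0 P, EP1 P & EP2 P].

Definition consistent_ideals : {set {set T}} :=
  [set I : {set T} |
     [forall x, forall y, (y \in I) && le x y ==> (x \in I)] &&
     [forall p in I, forall q in I, ~~ inc p q]].

End PIP.

Definition order_isomorphism (T1 T2 : finType) (le1 : rel T1) (le2 : rel T2)
    (D : {set T1}) (E : {set T2}) (g : T1 -> T2) : Prop :=
  [/\ {in D &, injective g}, g @: D = E
    & {in D &, {mono g : x y / le1 x y >-> le2 x y}}].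

(* Main.v *)
Require Import Defs.
From mathcomp Require Import all_boot all_order all_algebra.
From mathcomp Require Import reals constructive_ereal.
From mathcomp Require Import lra.

(** Minimizers are residual-closed sets.  For a maximum flow, an (s,t)-cut is minimum
    exactly when it is closed under residual reachability ([min_cut_closed],
    [closed_cut_capacity]).  By the second half of [represents], legalizing a
    minimum cut gives a legal minimum cut, so the minimum of f is the minimum
    cut capacity (up to the constant K), and psi identifies the minimizers with
    the legal closed cuts ([minimizersP]).

    The main tool is then [closed_legalize]: legalizing a closed cut leaves it
    closed.  The deleted vertices therefore propagate: if a vertex of X is
    deleted because its layer is crowded, every vertex of X from which it is
    reachable is deleted too, and so lies in a crowded layer itself
    ([crowding_up]).  Applied to closed cuts generated by one or two vertices,
    this has the following consequences.
    - X0 is contained in every closed cut, in particular in its own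
      legalization, so it is legal; and no vertex reachable from an element of
      Sigma shares a layer with a different vertex of X0 ([free_vertex_X0]).
      A closed cut is X0 plus a union of strongly connected components, and if
      it is legal these components belong to Sigma; so tau matches the
      consistent ideals with the legal closed cuts ([tau_closed], [tau_legal],
      [closed_legal_tau]).
    - Colour each component in Sigma with the set of layers that it meets, and
      say that two distinct components clash when they share a colour.  If C
      and D clash and C <= E, then every colour of E also occurs below D, on a
      component other than E ([layers_clash_up]).

    The second property, together with the fact that no two distinct elements
    below a common one share a colour and that every element has a colour, makes
    any finite poset an elementary PIP ([elementary_pip]).  It forces clashing
    elements to have the same colour set, so that clashing or being equal is an
    equivalence relation, whose classes are the parts required by EP0; and it forces every clashing
    pair to be minimally inconsistent.  EP1 and EP2 follow by applying it
    across two parts. *)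

Set Implicit Arguments.
Unset Strict Implicit.
Unset Printing Implicit Defensive.

Import Order.TTheory GRing.Theory Num.Theory.

Local Open Scope ring_scope.

(** * Rainbow-coloured posets as elementary PIPs *)

Section ElementaryPIP.
Variables (T : finType) (le inc : rel T) (C : finType) (col : T -> {set C}).
Hypothesis le_refl : reflexive le.
Hypothesis le_anti : antisymmetric le.
Hypothesis le_trans : transitive le.

Definition clash (p q : T) : Prop :=
  p <> q /\ exists i, i \in col p /\ i \in col q.

Hypothesis incP : forall p q,
  reflect (exists p' q', [/\ clash p' q', le p' p & le q' q]) (inc p q).
Hypothesis col_neq0 : forall p, exists i, i \in col p.
Hypothesis down_rainbow : forall p q r i,
  le p r -> le q r -> i \in col p -> i \in col q -> p = q.
Hypothesis clash_up : forall p q r j,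
  clash p q -> le p r -> j \in col r ->
  exists r', [/\ le r' q, r' <> r & j \in col r'].

Lemma clash_sym p q : clash p q -> clash q p.
Proof. by case=> npq [i [ip iq]]; split=> [/esym//|]; exists i. Qed.

Lemma clash_inc p q : clash p q -> inc p q.
Proof. by move=> cl; apply/incP; exists p, q; split. Qed.

(** Going up from p' to p, the shared colour of p and q must reappear below q';
    below q it can only sit on q itself, so q <= q'. *)
Lemma clash_minimal p q p' q' :
  clash p q -> clash p' q' -> le p' p -> le q' q -> q' = q.
Proof.
move=> [_ [i [ip iq]]] cl' lep leq.
have [r [lerq' _ ir]] := clash_up cl' lep ip.
have lerq := le_trans lerq' leq.
have rq : r = q := down_rainbow lerq (le_refl q) ir iq.
by apply: le_anti; rewrite leq -rq lerq'.
Qed.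

Lemma clash_min_inc p q : clash p q <-> min_inc le inc p q.
Proof.
split=> [cl|[/incP[p' [q' [cl lep leq]]] min]]; last first.
  by have [<- <-] := min p' q' lep leq (clash_inc cl).
split=> [|p' q' lep leq]; first exact: clash_inc.
case/incP=> p1 [q1 [cl1 le1 le2]].
have lep1 := le_trans le1 lep; have leq1 := le_trans le2 leq.
have Eq := clash_minimal cl cl1 lep1 leq1.
have Ep := clash_minimal (clash_sym cl) (clash_sym cl1) leq1 lep1.
by split; apply: le_anti; [rewrite lep -Ep le1|rewrite leq -Eq le2].
Qed.

(** A colour of q reappears below p on an element clashing with q; minimality
    of the clash between p and q forces this element to be p. *)
Lemma clash_sub_col p q : clash p q -> col q \subset col p.
Proof.
move=> cl; apply/subsetP=> j jq.
have [r [lerp nrq jr]] := clash_up (clash_sym cl) (le_refl q) jq.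
have cl' : clash q r by split=> [/esym//|]; exists j.
by rewrite -(clash_minimal (clash_sym cl) cl' (le_refl q) lerp).
Qed.

Lemma clash_eq_col p q : p <> q -> (clash p q <-> col p = col q).
Proof.
move=> npq; split=> [cl|E]; last first.
  by split=> //; have [i ip] := col_neq0 p; exists i; rewrite -E.
apply/eqP; rewrite eqEsubset (clash_sub_col cl).
by rewrite (clash_sub_col (clash_sym cl)).
Qed.

(** Elements with the same colours form a part; a part may be empty, since every
    set of colours gets an index. *)
Definition part (i : 'I_#|{set C}|) : {set T} :=
  [set p | col p == enum_val i].

Lemma eq_part i p q : p \in part i -> q \in part i -> col p = col q.
Proof. by rewrite !inE => /eqP-> /eqP->. Qed.

Lemma mem_part i p q : p \in part i -> col q = col p -> q \in part i.
Proof. by rewrite !inE => pi ->. Qed.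

Lemma part_disj i j p : p \in part i -> p \in part j -> i = j.
Proof. by rewrite !inE => /eqP-> /eqP/enum_val_inj. Qed.

Lemma part_clash i p q : p \in part i -> q \in part i -> p <> q -> clash p q.
Proof. by move=> pi qi npq; apply/(clash_eq_col npq); apply: eq_part pi qi. Qed.

Lemma part_down i p q r :
  p \in part i -> q \in part i -> le p r -> le q r -> p = q.
Proof.
move=> pi qi lep leq; have [c cp] := col_neq0 p.
by apply: (down_rainbow lep leq cp); rewrite -(eq_part pi qi).
Qed.

(** The form in which [clash_up] is used for EP1 and EP2: a relation x <= y
    between two parts pushes every other element x' of the part of x above an
    element of the part of y, which cannot be y. *)
Lemma part_below i j x x' y :
  x \in part i -> x' \in part i -> x' <> x -> y \in part j -> le x y ->
  exists z, [/\ z \in part j, z <> y & le z x'].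
Proof.
move=> xi x'i nxx' yj lexy; have [c cy] := col_neq0 y.
have clx : clash x x' by apply: (part_clash xi x'i); apply/nesym.
have [z [lez nzy cz]] := clash_up clx lexy cy.
exists z; split=> //; apply: (mem_part yj).
by apply/(clash_eq_col nzy); split=> //; exists c.
Qed.

Lemma elementary_pip : is_elementary_pip le inc.
Proof.
split; [split=> //|].
- move=> p q; apply/incP/incP=> -[p' [q' [cl lep leq]]];
  by exists q', p'; split=> //; apply: clash_sym.
- move=> p q /incP[p' [q' [[npq [i [ip iq]]] lep leq]]] [r [pr qr]].
  by apply/npq/(down_rainbow (le_trans lep pr) (le_trans leq qr) ip iq).
- move=> p q p' q' lep leq /incP[p1 [q1 [cl l1 l2]]]; apply/incP.
  by exists p1, q1; split=> //; [apply: le_trans lep|apply: le_trans leq].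
exists #|{set C}|, part.
have other i (x : T) : (2 <= #|part i|)%N -> exists2 x', x' \in part i & x' <> x.
  case/card_gt1P=> a [b [ai bi nab]].
  have [Ea|/eqP nax] := eqVneq a x; last by exists a.
  by exists b => // Eb; rewrite Ea Eb eqxx in nab.
split.
- split.
  + apply/setP=> p; rewrite inE; apply/bigcupP.
    by exists (enum_rank (col p)) => //; rewrite inE enum_rankK.
  + move=> i j nij; apply/pred0P=> p /=; apply/negP=> /andP[pi pj].
    by rewrite (part_disj pi pj) eqxx in nij.
  + move=> x y /eqP nxy; rewrite -clash_min_inc (clash_eq_col nxy).
    split=> [E|[i [xi yi]]]; last exact: eq_part xi yi.
    by exists (enum_rank (col x)); rewrite !inE -E enum_rankK.
- move=> i j y nij ci Ej [x [xi /andP[_ lexy]]].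
  have [x' x'i nx'] := other i x ci.
  have yj : y \in part j by rewrite Ej inE.
  have [z [zj nzy _]] := part_below xi x'i nx' yj lexy.
  by move: zj; rewrite Ej inE => /eqP.
have strict i j x y : i != j -> x \in part i -> y \in part j -> le x y -> slt le x y.
  move=> nij xi yj lexy; rewrite /slt lexy andbT; apply/eqP=> E.
  by rewrite -E in yj; rewrite (part_disj xi yj) eqxx in nij.
(* A single comparable pair x <= y between the two parts already produces the
   second alternative of EP2, with x as the exceptional element of part i. *)
have cross i j x y : i != j -> (2 <= #|part i|)%N -> x \in part i ->
    y \in part j -> le x y -> exists2 z, z \in part j &
    forall x' y', x' \in part i :\ x -> y' \in part j :\ z ->
      slt le x y' /\ slt le z x'.
  move=> nij ci xi yj lexy; have [x1 x1i nx1] := other i x ci.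
  (* Two elements of part j below a common element coincide, so a would lie
     both above and below the same element. *)
  have noloop a b b' : a \in part i -> b \in part j -> b' \in part j ->
      le b a -> le a b' -> False.
    move=> ai bj b'j leba leab.
    have E := part_down bj b'j (le_trans leba leab) (le_refl b').
    have Eab : a = b by apply: le_anti; rewrite leba E leab.
    by rewrite -Eab in bj; rewrite (part_disj ai bj) eqxx in nij.
  (* The exceptional element z of part j is the one found below some x1 <> x;
     the choice of x1 does not matter in the end. *)
  have [z [zj nzy lez]] := part_below xi x1i nx1 yj lexy.
  have above y' : y' \in part j -> y' <> z -> le x y'.
    move=> y'j ny'; have [w [wi _ lewy]] := part_below zj y'j ny' x1i lez.
    have [<-//|/eqP nwx] := eqVneq w x.
    have [u [uj _ leuw]] := part_below xi wi nwx yj lexy.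
    by case: (noloop w u y').
  exists z => // x' y'; rewrite !in_setD1 => /andP[/eqP nx' x'i] /andP[/eqP ny' y'j].
  split; first by exact: (strict _ _ _ _ nij xi y'j (above y' y'j ny')).
  have [u [uj _ leu]] := part_below xi x'i nx' yj lexy.
  apply: (strict _ _ _ _ _ zj x'i); first by rewrite eq_sym.
  have [<-//|/eqP nuz] := eqVneq u z.
  have lexx' := le_trans (above u uj nuz) leu.
  by case: nx'; rewrite (part_down xi x'i lexx' (le_refl x')).
move=> i j nij ci cj.
have [[x y]|no] := pickP [pred xy : T * T |
  [&& xy.1 \in part i, xy.2 \in part j & le xy.1 xy.2 || le xy.2 xy.1]].
  case/and3P=> /= xi yj /orP[lexy|leyx]; right.
    by have [z zj H] := cross i j x y nij ci xi yj lexy; exists x, z.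
  have nji : j != i by rewrite eq_sym.
  have [z zi H] := cross j i y x nji cj yj xi leyx.
  by exists z, y; split=> // x' y' x'i y'j; have [] := H y' x' y'j x'i.
left=> x y xi yj; apply/andP; rewrite -negb_or.
by have /= := no (x, y); rewrite xi yj /= => ->.
Qed.

End ElementaryPIP.

(** * Minimum cuts and residual-closed sets *)

Section MaxFlowMinCut.
Variables (R : realType) (n k : nat) (N : network R n k).
Variable phi : vertex n k * vertex n k -> R.
Local Notation V := (vertex n k).
Local Notation E := (edges N).
Hypothesis flow_phi : is_flow N phi.

Definition net_outflow (d : V * V -> R) v : R := outflow N d v - inflow N d v.

(** The directions in which phi can be moved a little without violating the
    bounds on an edge.  They form a convex cone, so the residual steps of a
    walk can simply be added up, even if an edge is used several times. *)
Definition residual_direction (d : V * V -> R) : Prop :=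
  forall a, a \in E ->
    (0 < d a -> ((phi a)%:E < capacity N a)%E) /\ (d a < 0 -> 0 < phi a).

Lemma residual_directionD d1 d2 :
  residual_direction d1 -> residual_direction d2 ->
  residual_direction (fun a => d1 a + d2 a).
Proof.
move=> D1 D2 a aE; have [p1 n1] := D1 a aE; have [p2 n2] := D2 a aE.
split=> h.
  by have [/p1//|h1] := ltP 0 (d1 a); apply: p2; lra.
by have [/n1//|h1] := ltP (d1 a) 0; apply: n2; lra.
Qed.

Lemma net_outflowD d1 d2 v :
  net_outflow (fun a => d1 a + d2 a) v = net_outflow d1 v + net_outflow d2 v.
Proof. by rewrite /net_outflow /outflow /inflow !big_split /=; lra. Qed.

Lemma net_outflowZ e d v : net_outflow (fun a => e * d a) v = e * net_outflow d v.
Proof. by rewrite /net_outflow /outflow /inflow -!mulr_sumr mulrBr. Qed.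

Lemma net_outflow_edge u v w : (u, v) \in E ->
  net_outflow (fun a => (a == (u, v))%:R) w = (w == u)%:R - (w == v)%:R.
Proof.
move=> uvE.
have unit_sum p : \sum_(a in E | p a) (a == (u, v))%:R = (p (u, v))%:R :> R.
  have [puv|npuv] := boolP (p (u, v)).
    rewrite (bigD1 (u, v)) ?uvE //= eqxx big1 ?addr0 // => a.
    by case/andP=> _ /negbTE->.
  rewrite big1 // => a /andP[_ pa]; case: eqP => // Ea.
  by rewrite -Ea pa in npuv.
by rewrite /net_outflow /outflow /inflow !unit_sum /= (eq_sym w) (eq_sym w).
Qed.

(** A residual step is a unit of flow pushed forward along an edge with slack
    or cancelled on an edge carrying flow; a residual walk is the sum of its
    steps, and the net outflows of the inner vertices cancel. *)
Lemma reach_direction u v : reach N phi u v -> exists2 d,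
  residual_direction d & forall w, net_outflow d w = (w == u)%:R - (w == v)%:R.
Proof.
case/connectP=> p + ->; elim: p u => [|x p IH] u /=.
  move=> _; exists (fun=> 0) => [a _|w]; first by rewrite ltxx.
  by rewrite subrr /net_outflow /outflow /inflow !big1 ?subrr.
case/andP=> ux /IH[d dD dE].
suff [d1 D1 E1] : exists2 d1, residual_direction d1 &
    forall w, net_outflow d1 w = (w == u)%:R - (w == x)%:R.
  exists (fun a => d1 a + d a); first exact: residual_directionD.
  by move=> w; rewrite net_outflowD E1 dE; lra.
case/orP: ux => /andP[aE ha].
  exists (fun a => (a == (u, x))%:R) => [a _|w]; last exact: net_outflow_edge.
  by case: eqP => [->|_]; rewrite ?ltxx ?ltr10; split.
exists (fun a => -1 * (a == (x, u))%:R) => [a _|w]; last first.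
  by rewrite net_outflowZ net_outflow_edge //; lra.
case: eqP => [->|_]; last by rewrite mulr0 ltxx.
by split=> //; rewrite mulr1 ltr0N1.
Qed.

(** Each edge tolerates all small enough steps, and there are finitely many
    edges. *)
Lemma direction_step d : residual_direction d -> exists2 e, 0 < e &
  forall a, a \in E ->
    0 <= phi a + e * d a /\ ((phi a + e * d a)%:E <= capacity N a)%E.
Proof.
move=> dD.
suff [e e0 H] : exists2 e, 0 < e & forall a, a \in enum E ->
    forall x, 0 < x <= e ->
    0 <= phi a + x * d a /\ ((phi a + x * d a)%:E <= capacity N a)%E.
  exists e => // a aE; apply: H; rewrite ?mem_enum ?e0 //=.
have: {subset enum E <= E} by move=> a; rewrite mem_enum.
elim: (enum E) => [_|a s IH sE]; first by exists 1.
have aE : a \in E by apply: sE; rewrite mem_head.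
have [|e1 e10 H1] := IH; first by move=> b bs; apply: sE; rewrite inE bs orbT.
suff [e2 e20 H2] : exists2 e, 0 < e & forall x, 0 < x <= e ->
    0 <= phi a + x * d a /\ ((phi a + x * d a)%:E <= capacity N a)%E.
  exists (Num.min e1 e2); first by rewrite lt_min e10.
  move=> b; rewrite inE => bs x /andP[x0].
  rewrite le_min => /andP[x1 x2].
  case/orP: bs => [/eqP->|bs]; first by apply: H2; rewrite x0.
  by apply: H1 => //; rewrite x0.
have [phi0 phic] := flow_phi.1 a aE; have [dp dn] := dD a aE.
have [d0|d0|d0] := ltgtP (d a) 0.
- have p0 := dn d0; exists (phi a / - d a); first by rewrite divr_gt0 // oppr_gt0.
  move=> x /andP[x0]; rewrite ler_pdivlMr ?oppr_gt0 // => xd.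
  split; first by lra.
  by apply: le_trans phic; rewrite lee_fin; nra.
- have pc := dp d0; case: (capacity N a) pc phic => [c| |] //.
  + rewrite !lte_fin !lee_fin => pc _; exists ((c - phi a) / d a).
      by rewrite divr_gt0 // subr_gt0.
    move=> x /andP[x0]; rewrite ler_pdivlMr // => xd.
    by rewrite lee_fin; split; [nra|lra].
  + by move=> _ _; exists 1 => // x /andP[x0 _]; rewrite leey; split=> //; nra.
by exists 1 => // x _; rewrite d0 mulr0 addr0.
Qed.

(** Otherwise a small multiple of the direction of an augmenting path could be
    added to phi, which would increase its value. *)
Lemma max_flow_no_path : is_max_flow N phi -> ~~ reach N phi Source Sink.
Proof.
case=> _ max; apply/negP=> /reach_direction[d dD dE].
have [e e0 He] := direction_step dD.
have exE v : net_outflow (fun a => phi a + e * d a) v = net_outflow phi v + e * net_outflow d v.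
  by rewrite net_outflowD net_outflowZ.
have: flow_value N (fun a => phi a + e * d a) <= flow_value N phi.
  apply: max; split=> // v vs vt.
  apply/esym/eqP; rewrite -subr_eq0; apply/eqP.
  have:= exE v; rewrite dE (negbTE vs) (negbTE vt) subrr mulr0 addr0.
  by rewrite /net_outflow => ->; rewrite (flow_phi.2 v vs vt) subrr.
by have:= exE Source; rewrite dE eqxx /net_outflow /flow_value /= => ->; lra.
Qed.

Definition cut_net_flow (X : {set V}) : R :=
  \sum_(a in E | (a.1 \in X) && (a.2 \notin X)) phi a
  - \sum_(a in E | (a.1 \notin X) && (a.2 \in X)) phi a.

(** Sum the conservation law over X: edges inside X contribute twice, with
    opposite signs. *)
Lemma cut_net_flowE X : st_cut X -> cut_net_flow X = flow_value N phi.
Proof.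
case/andP=> sX tX.
have ->: flow_value N phi = \sum_(v in X) net_outflow phi v.
  rewrite (bigD1 Source) //= big1 ?addr0 // => v /andP[vX vs].
  rewrite /net_outflow (flow_phi.2 v vs) ?subrr //.
  by apply: contraNneq tX => <-.
rewrite sumrB.
have ->: \sum_(v in X) outflow N phi v = \sum_(a in E | a.1 \in X) phi a.
  rewrite [RHS](partition_big (fun a : V * V => a.1) (mem X)) /=; last first.
    by move=> a /andP[].
  apply: eq_bigr => v vX; apply: eq_bigl => a.
  by case: eqP => [->|]; rewrite ?vX ?andbT ?andbF.
have ->: \sum_(v in X) inflow N phi v = \sum_(a in E | a.2 \in X) phi a.
  rewrite [RHS](partition_big (fun a : V * V => a.2) (mem X)) /=; last first.
    by move=> a /andP[].
  apply: eq_bigr => v vX; apply: eq_bigl => a.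
  by case: eqP => [->|]; rewrite ?vX ?andbT ?andbF.
rewrite (bigID (fun a : V * V => a.2 \in X)) /=.
rewrite [X in _ = _ - X](bigID (fun a : V * V => a.1 \in X)) /=.
rewrite /cut_net_flow.
have inner : \sum_(a in E | (a.1 \in X) && (a.2 \in X)) phi a =
    \sum_(a | (a \in E) && (a.2 \in X) && (a.1 \in X)) phi a.
  by apply: eq_bigl => a; rewrite -andbA [X in _ && X = _]andbC.
have into : \sum_(a in E | (a.1 \notin X) && (a.2 \in X)) phi a =
    \sum_(a | (a \in E) && (a.2 \in X) && (a.1 \notin X)) phi a.
  by apply: eq_bigl => a; rewrite -andbA [X in _ && X = _]andbC.
rewrite into -inner.
under [X in _ = X + _ - _]eq_bigl do rewrite -andbA.
under [X in _ = _ + X - _]eq_bigl do rewrite -andbA.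
by lra.
Qed.

Definition residual_closed (X : {set V}) : Prop :=
  forall u v, u \in X -> reach N phi u v -> v \in X.

Lemma step_closed (X : {set V}) :
  (forall u v, u \in X -> residual N phi u v -> v \in X) -> residual_closed X.
Proof.
move=> cl u v uX /connectP[p + ->]; elim: p u uX => //= x p IH u uX /andP[ux].
by apply: IH; apply: cl uX ux.
Qed.

(** Closedness says that the edges leaving X are saturated and that those
    entering X carry no flow. *)
Lemma closed_cut_capacity X : st_cut X -> residual_closed X ->
  cut_capacity N X = (flow_value N phi)%:E.
Proof.
move=> cX clX; rewrite -(cut_net_flowE cX) /cut_net_flow.
rewrite [X in _ - X]big1 ?subr0 => [|[u v] /= /and3P[aE uX vX]]; last first.
  have [phi0 _] := flow_phi.1 _ aE; apply/eqP; rewrite eq_le phi0 andbT.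
  rewrite leNgt; apply: contra uX => p0.
  by apply: clX vX _; apply: connect1; rewrite /residual aE p0 orbT.
rewrite -sumEFin; apply: eq_bigr => -[u v] /= /and3P[aE uX vX].
have [_ phic] := flow_phi.1 _ aE; apply/eqP; rewrite eq_le phic andbT.
rewrite leNgt; apply: contra vX => p0.
by apply: clX uX _; apply: connect1; rewrite /residual aE p0.
Qed.

Lemma flow_value_le_cut X : st_cut X ->
  ((flow_value N phi)%:E <= cut_capacity N X)%E.
Proof.
move=> cX; rewrite -(cut_net_flowE cX).
apply: (@le_trans _ _ (\sum_(a in E | (a.1 \in X) && (a.2 \notin X)) phi a)%:E).
  rewrite lee_fin gerBl; apply: sumr_ge0 => a /andP[aE _].
  by have [] := flow_phi.1 a aE.
rewrite -sumEFin; apply: lee_sum => a /andP[aE _].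
by have [] := flow_phi.1 a aE.
Qed.

(** A residual step leaving X makes the inequality between net flow and
    capacity strict, either on a leaving edge with slack or on an entering edge
    with positive flow. *)
Lemma min_cut_closed X : st_cut X ->
  (cut_capacity N X <= (flow_value N phi)%:E)%E -> residual_closed X.
Proof.
move=> cX leX; apply: step_closed => u v uX uv; apply/negPn/negP=> vX.
move: leX; rewrite -(cut_net_flowE cX) leNgt => /negP; apply.
set out := \sum_(a in E | (a.1 \in X) && (a.2 \notin X)) phi a.
set inn := \sum_(a in E | (a.1 \notin X) && (a.2 \in X)) phi a.
have inn_ge0 : 0 <= inn.
  by apply: sumr_ge0 => a /andP[aE _]; have [] := flow_phi.1 a aE.
have out_le : (out%:E <= cut_capacity N X)%E.
  rewrite -sumEFin; apply: lee_sum => a /andP[aE _].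
  by have [] := flow_phi.1 a aE.
case/orP: uv => /andP[aE slack].
  suff: (out%:E < cut_capacity N X)%E.
    by apply: le_lt_trans; rewrite lee_fin /cut_net_flow -/out -/inn; lra.
  rewrite /out /cut_capacity -sumEFin.
  rewrite (bigD1 (u, v)) /= ?aE ?uX ?vX //.
  rewrite [ltRHS](bigD1 (u, v)) /= ?aE ?uX ?vX //.
  apply: lte_leD => //.
    by rewrite sumEFin.
  by apply: lee_sum => a /andP[/andP[aE' _] _]; have [] := flow_phi.1 a aE'.
apply: lt_le_trans out_le; rewrite lte_fin /cut_net_flow -/out -/inn.
suff: 0 < inn by lra.
rewrite /inn (bigD1 (v, u)) /= ?aE ?uX ?vX //.
apply: ltr_wpDr slack; apply: sumr_ge0 => a /andP[/andP[aE' _] _].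
by have [] := flow_phi.1 a aE'.
Qed.

End MaxFlowMinCut.

(** * Legal cuts and legalization *)

Section Legalization.
Variables (n k : nat).
Local Notation V := (vertex n k).
Implicit Type X : {set V}.

Lemma mem_layer (i j : 'I_n) (a : 'I_k) : (Node j a \in layer k i) = (j == i).
Proof. by apply/imsetP/eqP=> [[b _ [->]]//|->]; exists a. Qed.

Lemma card_layer_gt1P X (i : 'I_n) : reflect
  (exists a b : 'I_k, [/\ Node i a \in X, Node i b \in X & a <> b])
  (1 < #|X :&: layer k i|)%N.
Proof.
apply: (iffP card_gt1P) => [[u [v []]]|[a [b [aX bX nab]]]].
  rewrite !in_setI => /andP[uX /imsetP[a _ Ea]] /andP[vX /imsetP[b _ Eb]] nuv.
  rewrite {}Ea {}Eb in uX vX nuv; exists a, b; split=> // Eab.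
  by rewrite Eab eqxx in nuv.
exists (Node i a), (Node i b); rewrite !inE !mem_layer aX bX eqxx.
by split=> //; apply/eqP=> -[].
Qed.

Lemma legal_cutP X : reflect
  (st_cut X /\ forall i a b, Node i a \in X -> Node i b \in X -> a = b)
  (legal_cut X).
Proof.
apply: (iffP andP) => -[cX leX]; split=> //.
  move=> i a b aX bX; apply/eqP/negPn/negP => /eqP nab.
  have := forallP leX i; rewrite leqNgt => /card_layer_gt1P; apply.
  by exists a, b.
apply/forallP=> i; rewrite leqNgt; apply/card_layer_gt1P=> -[a [b [aX bX nab]]].
exact/nab/(leX i).
Qed.

Lemma legalize_crowded X (i : 'I_n) (a b : 'I_k) :
  Node i a \in X -> Node i b \in X -> a <> b -> Node i a \notin legalize X.
Proof.
move=> aX bX nab; rewrite in_setD aX andbT negbK; apply/bigcupP.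
by exists i; [apply/card_layer_gt1P; exists a, b|rewrite mem_layer].
Qed.

Lemma notin_legalize X (v : V) : v \in X -> v \notin legalize X ->
  exists i (a b : 'I_k), [/\ v = Node i a, Node i b \in X & b <> a].
Proof.
move=> vX; rewrite in_setD vX andbT negbK => /bigcupP[i].
case/card_layer_gt1P=> a [b [aX bX nab]] /imsetP[c _ Ev]; exists i, c.
have [Eac|/eqP nac] := eqVneq a c; last by exists a.
by exists b; split=> // Ebc; apply: nab; rewrite Eac.
Qed.

Lemma legalize_legal X : st_cut X -> legal_cut (legalize X).
Proof.
case/andP=> sX tX; have subX := subsetDl X; apply/legal_cutP; split.
  rewrite /st_cut; apply/andP; split.
    by apply/negPn/negP=> /(notin_legalize sX)[i [a [b []]]].
  by apply: contra tX; apply: (subsetP (subX _)).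
move=> i a b aX bX; apply/eqP/negPn/negP=> /eqP nab.
have Xa := subsetP (subX _) _ aX; have Xb := subsetP (subX _) _ bX.
by have := legalize_crowded Xa Xb nab; rewrite aX.
Qed.

Lemma psi_sub (x y : kvec n k) : (psi x \subset psi y) = kvle x y.
Proof.
apply/subsetP/forallP=> [sub i|le [||i a]]; rewrite ?inE //.
  rewrite /kle; case: (unliftP ord0 (x i)) => [a Ea|->]; last by rewrite eqxx.
  by have := sub (Node i a); rewrite !inE /= Ea eqxx /= => /(_ isT)/eqP->; rewrite eqxx ?orbT.
rewrite /= => /eqP E; have := le i; rewrite /kle E => /orP[|/eqP<-//].
by move/eqP/(congr1 val).
Qed.

End Legalization.

(** * The components of a network representing a function *)

Section RepresentingNetwork.
Variables (R : realType) (n k : nat) (f : kvec n k -> \bar R).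
Variables (N : network R n k) (phi : vertex n k * vertex n k -> R).
Hypothesis Nf : represents N f.
Hypothesis maxphi : is_max_flow N phi.
Local Notation V := (vertex n k).
Local Notation r := (reach N phi).
Local Notation closed_set := (residual_closed N phi).
Local Notation ST := (Sigma_type N phi).
Local Notation "C <=S D" := (Sigma_le N phi C D) (at level 70).

Implicit Types (u v w : V) (X : {set V}) (C D : ST) (I J : {set ST}).

Lemma reach_trans u v w : r u v -> r v w -> r u w.
Proof. by move=> uv; apply: connect_trans. Qed.

Lemma reach_refl v : r v v. Proof. exact: connect0. Qed.
#[local] Hint Resolve reach_refl : core.

(** The legalized cut is still minimum, since legalizing does not increase the
    capacity, and minimum cuts are closed. *)
Lemma closed_legalize X : st_cut X -> closed_set X -> closed_set (legalize X).
Proof.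
move=> cX clX; have /legal_cutP[cL _] := legalize_legal cX.
apply: (min_cut_closed maxphi.1 cL).
by rewrite -(closed_cut_capacity maxphi.1 cX clX); case: Nf => _; apply.
Qed.

Lemma X0_sub X : Source \in X -> closed_set X -> X0 N phi \subset X.
Proof. by move=> sX clX; apply/subsetP=> v; rewrite inE; apply: clX. Qed.

Lemma X0_closed_cut : st_cut (X0 N phi) /\ closed_set (X0 N phi).
Proof.
split; last by move=> u v; rewrite !inE; apply: reach_trans.
by rewrite /st_cut !inE reach_refl (max_flow_no_path maxphi.1).
Qed.

(** Legalizing the minimum cut X0 gives a legal cut whose capacity is the value
    of the flow, so the minimum of f is attained at the minimum cuts. *)
Lemma minimizersP x : x \in minimizers f <-> closed_set (psi x).
Proof.
have [[K fK] _] := Nf; have [c0 cl0] := X0_closed_cut.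
have cut_psi (y : kvec n k) : st_cut (psi y) by have /legal_cutP[] := psi_legal y.
have le_f y z : (f y <= f z)%E =
    (cut_capacity N (psi y) <= cut_capacity N (psi z))%E.
  by rewrite !fK leeD2rE.
rewrite inE; split=> [/forallP min|clx].
  apply: (min_cut_closed maxphi.1 (cut_psi x)).
  have legX0 := legalize_legal c0.
  have := min (psi_inv (legalize (X0 N phi))); rewrite le_f psi_invK //.
  have /legal_cutP[cL _] := legX0.
  by rewrite (closed_cut_capacity maxphi.1 cL) //; apply: closed_legalize.
apply/forallP=> y; rewrite le_f (closed_cut_capacity maxphi.1 _ clx) //.
exact: flow_value_le_cut maxphi.1 _ (cut_psi y).
Qed.

(** If w survived legalization then, since the legalized cut is closed, so
    would the crowded vertex reachable from w. *)
Lemma crowding_up X i a b w : st_cut X -> closed_set X ->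
  Node i a \in X -> Node i b \in X -> a <> b -> w \in X -> r w (Node i a) ->
  exists j c d, [/\ w = Node j c, Node j d \in X & d <> c].
Proof.
move=> cX clX aX bX nab wX wa; apply: notin_legalize => //.
apply: contra (legalize_crowded aX bX nab) => wL.
exact: closed_legalize wL wa.
Qed.

(** The vertices of the components in Sigma (see [scc_Sigma]): two distinct
    vertices of one layer reachable from v lie in one component, which is then
    crowded, or in two, which conflict unless one of them is crowded. *)
Definition free_vertex v : Prop :=
  [/\ ~~ r Source v, ~~ r v Sink
    & forall i a b, r v (Node i a) -> r v (Node i b) -> a = b].

Lemma free_vertex_reach v w :
  free_vertex v -> r v w -> ~~ r Source w -> free_vertex w.
Proof.
move=> [_ vt vleg] vw sw; split=> //; first exact: contra (reach_trans vw) vt.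
by move=> i a b wa wb; apply: (vleg i); apply: reach_trans vw _.
Qed.

(** The smallest closed cut containing p and q; two generators suffice to
    compare a pair of components. *)
Definition reach_cut p q : {set V} := [set w | [|| r Source w, r p w | r q w]].

Lemma reach_cut_closed p q : free_vertex p -> free_vertex q ->
  st_cut (reach_cut p q) /\ closed_set (reach_cut p q).
Proof.
move=> [_ pt _] [_ qt _]; split; last first.
  move=> u v; rewrite !inE => + uv.
  by case/or3P=> h; rewrite (reach_trans h uv) ?orbT.
rewrite /st_cut !inE reach_refl (negbTE pt) (negbTE qt) !orbF.
exact: (max_flow_no_path maxphi.1).
Qed.

(** Otherwise the legalization of the closed cut generated by v would be a
    closed cut that misses the vertex Node i b of X0. *)
Lemma free_vertex_X0 v i a b :
  free_vertex v -> r v (Node i a) -> r Source (Node i b) -> a = b.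
Proof.
move=> fv va sb; apply/eqP/negPn/negP => /eqP/nesym nba.
have [cX clX] := reach_cut_closed fv fv.
have bX : Node i b \in reach_cut v v by rewrite inE sb.
have aX : Node i a \in reach_cut v v by rewrite inE va !orbT.
have /legal_cutP[/andP[sL _] _] := legalize_legal cX.
have := legalize_crowded bX aX nba; apply/negP/negPn.
by apply: (subsetP (X0_sub sL (closed_legalize cX clX))); rewrite inE.
Qed.

Definition scc v : {set V} := [set w | r v w && r w v].

Lemma sccsP X : reflect (exists v, X = scc v) (X \in sccs N phi).
Proof.
apply: (iffP imsetP) => [[v _ ->]|[v ->]]; exists v => //;
by apply/setP=> w; rewrite !inE.
Qed.

Lemma scc_eq v w : w \in scc v -> scc v = scc w.
Proof.
rewrite inE => /andP[vw wv]; apply/setP=> u; rewrite !inE.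
by apply/andP/andP=> -[h1 h2]; split; apply: reach_trans; eassumption.
Qed.

Lemma scc_reach_scc u v : scc_reach N phi (scc u) (scc v) = r u v.
Proof.
apply/exists_inP/idP => [[u' + /exists_inP[v' + h]]|h]; last first.
  by exists u; [rewrite inE reach_refl|apply/exists_inP; exists v; rewrite // inE reach_refl].
rewrite !inE => /andP[uu' _] /andP[_ v'v].
exact: reach_trans uu' (reach_trans h v'v).
Qed.

Lemma mem_scc v : v \in scc v. Proof. by rewrite inE reach_refl. Qed.

Lemma scc_Sigma v : scc v \in Sigma N phi <-> free_vertex v.
Proof.
have sccv w : scc w \in sccs N phi by apply/sccsP; exists w.
rewrite in_set sccv /=; split=> [|[sv vt leg]].
  rewrite !negb_or => /and4P[sv vt crowd confl]; split.
  - by apply: contra sv => h; apply/exists_inP; exists v; rewrite ?mem_scc.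
  - by apply: contra vt => h; apply/exists_inP; exists v; rewrite ?mem_scc.
  move=> i a b va vb; apply/eqP/negPn/negP=> /eqP nab.
  (* Without reachable crowded components, the two components meet the layer
     in exactly one vertex each, so they conflict unless they are equal. *)
  have thin w : r v w -> (#|scc w :&: layer k i| <= 1)%N.
    move=> vw; rewrite leqNgt; apply: contra crowd => h.
    apply/exists_inP; exists (scc w); first exact: sccv.
    by rewrite scc_reach_scc vw; apply/existsP; exists i.
  case/negP: confl; apply/exists_inP; exists (scc (Node i a)); first exact: sccv.
  apply/exists_inP; exists (scc (Node i b)); first exact: sccv.
  rewrite !scc_reach_scc va vb /=; apply/andP; split.
    apply/eqP=> E; have := thin _ va; rewrite leqNgt => /card_layer_gt1P; apply.
    by exists a, b; rewrite {2}E !mem_scc.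
  apply/existsP; exists i; rewrite !eqn_leq !thin //= !card_gt0.
  by apply/andP; split; apply/set0Pn;
    [exists (Node i a)|exists (Node i b)]; rewrite inE mem_scc mem_layer eqxx.
rewrite !negb_or; apply/and4P; split.
- apply: contra sv => /exists_inP[w]; rewrite inE => /andP[_ wv] sw.
  exact: reach_trans sw wv.
- apply: contra vt => /exists_inP[w]; rewrite inE => /andP[vw _].
  exact: reach_trans vw.
- apply/negP=> /exists_inP[_ /sccsP[w ->]]; rewrite scc_reach_scc.
  case/andP=> vw /existsP[i] /card_layer_gt1P[a [b []]].
  rewrite !inE => /andP[wa _] /andP[wb _]; apply.
  by apply: (leg i); apply: reach_trans vw _.
apply/negP=> /exists_inP[_ /sccsP[u ->]] /exists_inP[_ /sccsP[w ->]].
rewrite !scc_reach_scc => /and4P[/eqP nuw vu vw /existsP[i /andP[/eqP cu /eqP cw]]].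
have pickl x : #|scc x :&: layer k i| = 1%N -> exists a, Node i a \in scc x.
  move=> c1; have: (0 < #|scc x :&: layer k i|)%N by rewrite c1.
  case/card_gt0P=> z; rewrite inE => /andP[zx /imsetP[a _ Ez]].
  by exists a; rewrite -Ez.
have [a au] := pickl u cu; have [b bw] := pickl w cw.
apply: nuw; rewrite (scc_eq au) (scc_eq bw); congr (scc (Node i _)).
move: au bw; rewrite !inE => /andP[ua _] /andP[wb _].
by apply: (leg i); [apply: reach_trans vu ua|apply: reach_trans vw wb].
Qed.

Lemma SigmaE (C : ST) v : v \in val C -> val C = scc v /\ free_vertex v.
Proof.
have := valP C; rewrite {1}inE => /andP[/sccsP[w Ew] _].
rewrite Ew => /scc_eq E; split=> //; apply/scc_Sigma.
by rewrite -E -Ew; apply: valP.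
Qed.

Lemma free_vertex_Sigma v : free_vertex v -> exists C : ST, v \in val C.
Proof. by move/scc_Sigma=> vS; exists (Sub (scc v) vS); rewrite SubK mem_scc. Qed.

Lemma Sigma_leE (C D : ST) u v : u \in val C -> v \in val D -> (C <=S D) = r v u.
Proof.
by move=> /SigmaE[EC _] /SigmaE[ED _]; rewrite /Sigma_le EC ED scc_reach_scc.
Qed.

Lemma Sigma_eq (C D : ST) v : v \in val C -> v \in val D -> C = D.
Proof. by move=> /SigmaE[EC _] /SigmaE[ED _]; apply: val_inj; rewrite EC ED. Qed.

Lemma Sigma_nonempty (C : ST) : exists v, v \in val C.
Proof.
have := valP C; rewrite {1}inE => /andP[/sccsP[w ->] _].
by exists w; rewrite mem_scc.
Qed.

Lemma Sigma_le_refl : reflexive (Sigma_le N phi).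
Proof. by move=> C; have [v vC] := Sigma_nonempty C; rewrite (Sigma_leE vC vC). Qed.

Lemma Sigma_le_anti : antisymmetric (Sigma_le N phi).
Proof.
move=> C D; have [u uC] := Sigma_nonempty C; have [v vD] := Sigma_nonempty D.
rewrite (Sigma_leE uC vD) (Sigma_leE vD uC) => /andP[vu uv].
by apply: (Sigma_eq uC); have [-> _] := SigmaE vD; rewrite inE vu.
Qed.

Lemma Sigma_le_trans : transitive (Sigma_le N phi).
Proof.
move=> D C B.
have [u uC] := Sigma_nonempty C; have [v vD] := Sigma_nonempty D.
have [w wB] := Sigma_nonempty B.
rewrite (Sigma_leE uC vD) (Sigma_leE vD wB) (Sigma_leE uC wB) => vu wv.
exact: reach_trans wv vu.
Qed.

Definition layers (C : ST) : {set 'I_n} := [set i | [exists a, Node i a \in val C]].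

Lemma layersP (C : ST) i :
  reflect (exists a, Node i a \in val C) (i \in layers C).
Proof. by rewrite inE; apply: existsP. Qed.

Lemma layers_card1 (C : ST) i :
  (i \in layers C) = (#|val C :&: layer k i| == 1)%N.
Proof.
apply/layersP/idP=> [[a aC]|/eqP c1]; last first.
  have: (0 < #|val C :&: layer k i|)%N by rewrite c1.
  case/card_gt0P=> z; rewrite inE => /andP[zC /imsetP[a _ Ez]].
  by exists a; rewrite -Ez.
rewrite eqn_leq card_gt0; apply/andP; split; last first.
  by apply/set0Pn; exists (Node i a); rewrite inE aC mem_layer eqxx.
have [EC [_ _ leg]] := SigmaE aC.
rewrite leqNgt; apply/card_layer_gt1P=> -[b [c []]].
by rewrite EC !inE => /andP[ab _] /andP[ac _]; apply; apply: (leg i).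
Qed.

Lemma Sigma_incP (C D : ST) : reflect
  (exists C' D', [/\ clash layers C' D', C' <=S C & D' <=S D])
  (Sigma_inc N phi C D).
Proof.
have meetE (C' D' : ST) : meet_same_layer (val C') (val D') =
    [exists i, (i \in layers C') && (i \in layers D')].
  by apply: eq_existsb => i; rewrite -!layers_card1.
apply: (iffP existsP) => [[C' /existsP[D' /and4P[nCD lC lD]]]|].
  rewrite meetE => /existsP[i /andP[iC iD]]; exists C', D'; split=> //.
  by split; [apply/eqP|exists i].
move=> [C' [D' [[nCD [i [iC iD]]] lC lD]]]; exists C'; apply/existsP; exists D'.
rewrite lC lD meetE; apply/and4P; split=> //; first exact/eqP.
by apply/existsP; exists i; rewrite iC.
Qed.

Lemma layers_neq0 C : exists i, i \in layers C.
Proof.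
have [[||i a] vC] := Sigma_nonempty C; last by exists i; apply/layersP; exists a.
  by have [_ [/negP]] := SigmaE vC.
by have [_ [_ /negP]] := SigmaE vC.
Qed.

Lemma layers_down C D B i :
  C <=S B -> D <=S B -> i \in layers C -> i \in layers D -> C = D.
Proof.
have [v vB] := Sigma_nonempty B; have [_ [_ _ leg]] := SigmaE vB.
move=> + + /layersP[a aC] /layersP[b bD].
rewrite (Sigma_leE aC vB) (Sigma_leE bD vB) => va vb.
by apply: (Sigma_eq aC); rewrite (leg i a b).
Qed.

(** [crowding_up] in the closed cut generated by B and D: a vertex of B in layer
    j reaches the crowded vertex of C, so another vertex of layer j is in this
    cut.  It is neither in X0 nor below B, hence it lies below D. *)
Lemma layers_clash_up C D B j : clash layers C D -> C <=S B -> j \in layers B ->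
  exists D', [/\ D' <=S D, D' <> B & j \in layers D'].
Proof.
move=> [nCD [i [/layersP[a aC] /layersP[b bD]]]] + /layersP[c cB].
rewrite (Sigma_leE aC cB) => wa.
have [_ fw] := SigmaE cB; have [_ fb] := SigmaE bD.
have nab : a <> b by move=> Eab; apply/nCD/(Sigma_eq aC); rewrite Eab.
have [cX clX] := reach_cut_closed fw fb.
have inX v : (v \in reach_cut (Node j c) (Node i b)) =
   [|| r Source v, r (Node j c) v | r (Node i b) v] by rewrite inE.
have [] := @crowding_up _ i a b (Node j c) cX clX; rewrite ?inX ?wa ?reach_refl ?orbT //.
move=> j' [c' [d [[<- <-]]]] {j' c'}; rewrite inX => dX ndc.
have nrd : ~~ r Source (Node j d).
  by apply/negP=> sd; apply: ndc; rewrite (free_vertex_X0 fw (reach_refl _) sd).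
have nwd : ~~ r (Node j c) (Node j d).
  by apply/negP=> wd; apply: ndc; have [_ _ leg] := fw; apply: (leg j).
rewrite (negbTE nrd) (negbTE nwd) /= in dX.
have [D' dD'] := free_vertex_Sigma (free_vertex_reach fb dX nrd).
exists D'; rewrite (Sigma_leE dD' bD); split=> //; last by apply/layersP; exists d.
by move=> E; case/negP: nwd; rewrite -(Sigma_leE dD' cB) E Sigma_le_refl.
Qed.

Lemma Sigma_elementary : is_elementary_pip (Sigma_le N phi) (Sigma_inc N phi).
Proof.
exact: (elementary_pip Sigma_le_refl Sigma_le_anti Sigma_le_trans Sigma_incP
          layers_neq0 layers_down layers_clash_up).
Qed.

(** ** Consistent ideals and legal closed cuts *)

Local Notation CI := (consistent_ideals (Sigma_le N phi) (Sigma_inc N phi)).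

Lemma consistent_idealP I : reflect
  ((forall C D, D \in I -> C <=S D -> C \in I) /\
   (forall C D, C \in I -> D \in I -> ~~ Sigma_inc N phi C D)) (I \in CI).
Proof.
rewrite inE; apply: (iffP andP) => -[down cons]; split.
- by move=> C D DI le; have /forallP/(_ D)/implyP := forallP down C; apply; rewrite DI.
- by move=> C D CinI DI; apply: (forall_inP (forall_inP cons C CinI)).
- by apply/forallP=> C; apply/forallP=> D; apply/implyP=> /andP[]; apply: down.
by apply/forall_inP=> C CinI; apply/forall_inP=> D; apply: cons.
Qed.

Lemma mem_tau I v :
  v \in tau N phi I <-> r Source v \/ exists2 C, C \in I & v \in val C.
Proof.
rewrite in_setU in_set; split=> [/orP[|/bigcupP[C]]|[->|[C CinI vC]]] //.
- by left.
- by right; exists C.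
by apply/orP; right; apply/bigcupP; exists C.
Qed.

(** A component reachable from an element of I and not contained in X0 belongs
    to Sigma again, hence to the ideal I. *)
Lemma tau_closed I : I \in CI -> closed_set (tau N phi I).
Proof.
case/consistent_idealP=> down _ u v /mem_tau hu uv; apply/mem_tau.
have [sv|sv] := boolP (r Source v); [by left|right].
case: hu => [su|[C CinI uC]]; first by rewrite (reach_trans su uv) in sv.
have [_ fu] := SigmaE uC.
have [D vD] := free_vertex_Sigma (free_vertex_reach fu uv sv).
by exists D => //; apply: (down D C CinI); rewrite (Sigma_leE vD uC).
Qed.

(** Two vertices of one layer cannot both lie in X0, whose legalization is X0
    itself; nor one in X0 and one in a component of I, by [free_vertex_X0]; nor
    in two components of I, which would be inconsistent. *)
Lemma tau_legal I : I \in CI -> legal_cut (tau N phi I).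
Proof.
case/consistent_idealP=> _ cons; apply/legal_cutP; split.
  apply/andP; split; first by apply/mem_tau; left.
  apply/negP=> /mem_tau[|[C _ tC]]; last by have [_ [_ /negP]] := SigmaE tC.
  exact/negP/(max_flow_no_path maxphi.1).
move=> i a b /mem_tau[sa|[C CinI aC]] /mem_tau[sb|[D DI bD]].
- have [c0 cl0] := X0_closed_cut.
  have /legal_cutP[/andP[sL _] leg] := legalize_legal c0.
  have /subsetP sub := X0_sub sL (closed_legalize c0 cl0).
  by apply: (leg i); apply: sub; rewrite inE.
- by have [_ fb] := SigmaE bD; rewrite (free_vertex_X0 fb (reach_refl _) sa).
- by have [_ fa] := SigmaE aC; rewrite (free_vertex_X0 fa (reach_refl _) sb).
have [ECD|nCD] := eqVneq C D.
  rewrite -ECD in bD; have [EC [_ _ leg]] := SigmaE aC.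
  by apply: (leg i) => //; move: bD; rewrite EC inE => /andP[].
case/negP: (cons C D CinI DI); apply/Sigma_incP; exists C, D.
rewrite !Sigma_le_refl; split=> //; split; first exact/eqP.
by exists i; split; apply/layersP; [exists a|exists b].
Qed.

Lemma closed_legal_tau X : legal_cut X -> closed_set X ->
  exists2 I, I \in CI & tau N phi I = X.
Proof.
case/legal_cutP=> /andP[sX tX] leg clX.
have sub0 := subsetP (X0_sub sX clX).
exists [set C : ST | val C \subset X].
  apply/consistent_idealP; split=> [C D|C D].
    have [u uC] := Sigma_nonempty C; have [v vD] := Sigma_nonempty D.
    rewrite !in_set (Sigma_leE uC vD) => /subsetP sub vu; apply/subsetP=> w.
    have [-> _] := SigmaE uC; rewrite inE => /andP[uw _].
    exact: clX (sub v vD) (reach_trans vu uw).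
  rewrite !in_set => /subsetP subC /subsetP subD; apply/Sigma_incP.
  move=> [C' [D' [[nCD [i [/layersP[a aC] /layersP[b bD]]]]]]].
  have [u uC] := Sigma_nonempty C; have [v vD] := Sigma_nonempty D.
  rewrite (Sigma_leE aC uC) (Sigma_leE bD vD) => ua vb; apply: nCD.
  have Eab : a = b by apply: (leg i); [apply: clX ua|apply: clX vb]; auto.
  by apply: (Sigma_eq aC); rewrite Eab.
apply/setP=> v; apply/idP/idP => [/mem_tau[sv|[C]]|vX].
- by apply: sub0; rewrite inE.
- by rewrite inE => /subsetP; apply.
apply/mem_tau; have [sv|sv] := boolP (r Source v); [by left|right].
have fv : free_vertex v.
  split=> //; first by apply: contra tX; apply: clX.
  by move=> i a b va vb; apply: (leg i); apply: clX vX _.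
have [C vC] := free_vertex_Sigma fv; exists C => //; rewrite inE.
apply/subsetP=> w; have [-> _] := SigmaE vC.
by rewrite inE => /andP[vw _]; apply: clX vX vw.
Qed.

Lemma tau_sub I J : (tau N phi I \subset tau N phi J) = (I \subset J).
Proof.
apply/idP/idP=> [/subsetP sub|sub].
  apply/subsetP=> C CinI; have [v vC] := Sigma_nonempty C.
  have /mem_tau[sv|[D DJ vD]] : v \in tau N phi J.
    by apply: sub; apply/mem_tau; right; exists C.
    by have [_ [/negP]] := SigmaE vC.
  by rewrite (Sigma_eq vC vD).
apply/subsetP=> v /mem_tau h; apply/mem_tau; case: h => [|[C CinI vC]]; first by left.
by right; exists C; rewrite ?(subsetP sub).
Qed.

End RepresentingNetwork.

Theorem theorem15 (R : realType) (n k : nat) (f : kvec n k -> \bar R)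
    (N : network R n k) (phi : vertex n k * vertex n k -> R) :
  ksubmodular f ->
  represents N f ->
  is_max_flow N phi ->
  [/\ is_elementary_pip (Sigma_le N phi) (Sigma_inc N phi),
      (forall I : {set Sigma_type N phi},
         I \in consistent_ideals (Sigma_le N phi) (Sigma_inc N phi) ->
         legal_cut (tau N phi I))
    & order_isomorphism
        (fun I J : {set Sigma_type N phi} => I \subset J) (@kvle n k)
        (consistent_ideals (Sigma_le N phi) (Sigma_inc N phi))
        (minimizers f)
        (fun I : {set Sigma_type N phi} => psi_inv (tau N phi I))].
Proof.
move=> _ Nf maxphi; split; first exact: Sigma_elementary Nf maxphi.
  exact: tau_legal Nf maxphi.
set D := consistent_ideals _ _.
have psi_tau I : I \in D -> psi (psi_inv (tau N phi I)) = tau N phi I.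
  by move=> ID; rewrite psi_invK //; apply: tau_legal Nf maxphi _ ID.
have mono : {in D &, {mono (fun I => psi_inv (tau N phi I)) :
    I J / I \subset J >-> kvle I J}}.
  by move=> I J ID JD; rewrite /= -psi_sub !psi_tau // tau_sub.
split=> //.
  move=> I J ID JD E; apply/eqP; rewrite eqEsubset.
  by rewrite -(mono I J) // -(mono J I) // E -psi_sub subxx.
apply/setP=> x; apply/imsetP/idP=> [[I ID ->]|/(minimizersP Nf maxphi) clx].
  by apply/(minimizersP Nf maxphi); rewrite psi_tau //; apply: tau_closed ID.
have [I ID E] := closed_legal_tau (psi_legal x) clx.
by exists I; rewrite // E psiK.
Qed.
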